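(* Let $m$ be a universal lower semicomputable discrete semimeasure. There exist an upper semicomputable sumtest $e$ for $m$, a constant $c>0$ and a number $N$ such that for every $n\ge N$ there is a string $x$ of length $n$ with \[ e(x)\ge c\,\frac{n}{(\log n)^5}. \]
   Context: A discrete semimeasure is a function $P$ from finite binary strings to non-negative reals with $\sum_x P(x)\le1$; lower semicomputable means it is the limit of a computable nondecreasing sequence of rational approximations. $m$ is universal if it is a lower semicomputable semimeasure such that for each lower semicomputable semimeasure $P$ there is $c>0$ with $P\le c\,m$. A sumtest for $m$ is a function $e$ from strings to non-negative reals with $\sum_x m(x)e(x)\le1$; upper semicomputable means it is the limit of a computable nonincreasing sequence of rational approximations. Logarithms are base 2. *)

(* Defs.v *)
From HB Require Import structures.
From mathcomp Require Import all_boot all_order all_algebra.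
From mathcomp Require Import all_classical all_reals all_analysis.
Set Implicit Arguments.
Unset Strict Implicit.
Unset Printing Implicit Defensive.
Import Order.TTheory GRing.Theory Num.Theory numFieldNormedType.Exports.
Local Open Scope classical_set_scope.
Local Open Scope ring_scope.

(* Codes for Kleene's mu-recursive functions on natural numbers.  Arguments
   form a list, and an argument read beyond its end is 0, so that codes need
   not carry an arity. *)
Inductive recfun : Type :=
| RZero
| RSucc
| RProj of nat
| RComp of recfun & seq recfun
| RPrec of recfun & recfun
| RMu of recfun.

(* [recfun_eval f v y]: the computation of f on v halts with value y.
   In [RMu], the search stops at the least n with f(n, v) = 0, and f(i, v)
   must be defined for all i < n. *)
Inductive recfun_eval : recfun -> seq nat -> nat -> Prop :=
| EvZero v : recfun_eval RZero v 0%N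
| EvSucc v : recfun_eval RSucc v (nth 0%N v 0).+1
| EvProj i v : recfun_eval (RProj i) v (nth 0%N v i)
| EvComp f gs v ws y :
    recfun_evals gs v ws -> recfun_eval f ws y ->
    recfun_eval (RComp f gs) v y
| EvPrec0 f g v y :
    recfun_eval f v y -> recfun_eval (RPrec f g) (0%N :: v) y
| EvPrecS f g n v z y :
    recfun_eval (RPrec f g) (n :: v) z -> recfun_eval g [:: n, z & v] y ->
    recfun_eval (RPrec f g) (n.+1 :: v) y
| EvMu f v n :
    (forall i, (i < n)%N -> exists z, recfun_eval f (i :: v) z.+1) ->
    recfun_eval f (n :: v) 0%N ->
    recfun_eval (RMu f) v n
with recfun_evals : seq recfun -> seq nat -> seq nat -> Prop :=
| EvNil v : recfun_evals [::] v [::]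
| EvCons g gs v w ws :
    recfun_eval g v w -> recfun_evals gs v ws ->
    recfun_evals (g :: gs) v (w :: ws).

(* The number whose binary expansion, most significant bit first, is 1x. *)
Definition string_code (x : seq bool) : nat :=
  foldl (fun a b : nat => (a.*2 + b)%N) 1%N (map nat_of_bool x).

Definition computable_nat (f : seq bool -> nat -> nat) : Prop :=
  exists p : recfun, forall x t,
    recfun_eval p [:: string_code x; t] (f x t).

(* A rational is presented as a triple (a, b, d) of naturals, for the value
   (a - b) / (d + 1). *)
Definition computable_rat (f : seq bool -> nat -> rat) : Prop :=
  exists a b d : seq bool -> nat -> nat,
    [/\ computable_nat a, computable_nat b, computable_nat d &
        forall x t, f x t = ((a x t)%:R - (b x t)%:R) / (d x t).+1%:R].

Definition lower_semicomputable (R : realType) (P : seq bool -> R) : Prop :=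
  exists f : seq bool -> nat -> rat,
    [/\ computable_rat f,
        forall x, nondecreasing_seq (f x) &
        forall x, (fun t => ratr (f x t) : R) @ \oo --> P x].

Definition upper_semicomputable (R : realType) (e : seq bool -> R) : Prop :=
  exists f : seq bool -> nat -> rat,
    [/\ computable_rat f,
        forall x, nonincreasing_seq (f x) &
        forall x, (fun t => ratr (f x t) : R) @ \oo --> e x].

Definition semimeasure (R : realType) (P : seq bool -> R) : Prop :=
  (forall x, 0 <= P x) /\
  (\esum_(x in [set: seq bool]) (P x)%:E <= 1)%E.

Definition universal (R : realType) (m : seq bool -> R) : Prop :=
  [/\ lower_semicomputable m,
      semimeasure m &
      forall P : seq bool -> R, lower_semicomputable P -> semimeasure P ->
        exists2 c : R, 0 < c & forall x, P x <= c * m x].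

Definition sumtest (R : realType) (m e : seq bool -> R) : Prop :=
  (forall x, 0 <= e x) /\
  (\esum_(x in [set: seq bool]) (m x * e x)%:E <= 1)%E.

Definition log2 (R : realType) (x : R) : R := ln x / ln 2.

(* Main.v *)
Require Import Defs.
From HB Require Import structures.
From mathcomp Require Import all_boot all_order all_algebra.
From mathcomp Require Import all_classical all_reals all_analysis.
From mathcomp Require Import zify ring lra.
Set Implicit Arguments.
Unset Strict Implicit.
Unset Printing Implicit Defensive.
Import Order.TTheory GRing.Theory Num.Theory numFieldNormedType.Exports.
Local Open Scope ring_scope.

(* Fix n, put q = n / O(log n) and let W_t be the mass that the time-t
   approximation of m gives to strings of length n, plus 1 / ((n+1)(n+2)).  Keep
   a prefix, initially empty, and the block E of its extensions to length n.
   Whenever q m_t(E) > 2 W_t, extend the prefix by one bit, towards the lighter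
   half of E.  Each extension discards mass at least W_t / q, never counted
   again, so after k extensions W_t >= (1 + 1/q)^k / ((n+1)(n+2)).  As W_t <= 2,
   this forces k < n, so E stabilizes to a nonempty block.  The test e = q / 4 on
   the final E and 0 elsewhere is approximated from above, and
   sum m e <= sum_n W / 2 <= 1. *)

(** * Closure properties of recursive functions *)

(** The length [k] is fixed because a code can rebuild its argument list only from finitely many
    projections. *)
Definition computes (k : nat) (F : seq nat -> nat) : Prop :=
  exists p, forall v, size v = k -> recfun_eval p v (F v).

Lemma computes_ext k F G :
  (forall v, size v = k -> F v = G v) -> computes k F -> computes k G.
Proof. by move=> FG [p hp]; exists p => v hv; rewrite -FG //; exact: hp. Qed.

Lemma computes_proj k i : computes k (fun v => nth 0%N v i).
Proof. by exists (RProj i) => v _; constructor. Qed.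

Lemma recfun_evals_proj v s :
  recfun_evals [seq RProj i | i <- s] v [seq nth 0%N v i | i <- s].
Proof. by elim: s => [|i s IH] /=; constructor => //; constructor. Qed.

Lemma computes_app1 k f F :
  computes 1 (fun v => f (nth 0%N v 0)) -> computes k F ->
  computes k (fun v => f (F v)).
Proof.
move=> [p hp] [pF hF]; exists (RComp p [:: pF]) => v hv.
apply: (EvComp (ws := [:: F v])); last exact: hp.
by apply: EvCons; [exact: hF | exact: EvNil].
Qed.

Lemma computes_app2 k f F G :
  computes 2 (fun v => f (nth 0%N v 0) (nth 0%N v 1)) ->
  computes k F -> computes k G -> computes k (fun v => f (F v) (G v)).
Proof.
move=> [p hp] [pF hF] [pG hG]; exists (RComp p [:: pF; pG]) => v hv.
apply: (EvComp (ws := [:: F v; G v])); last exact: hp.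
apply: EvCons; first exact: hF.
by apply: EvCons; [exact: hG | exact: EvNil].
Qed.

Lemma computes_app3 k f F G H :
  computes 3 (fun v => f (nth 0%N v 0) (nth 0%N v 1) (nth 0%N v 2)) ->
  computes k F -> computes k G -> computes k H ->
  computes k (fun v => f (F v) (G v) (H v)).
Proof.
move=> [p hp] [pF hF] [pG hG] [pH hH]; exists (RComp p [:: pF; pG; pH]) => v hv.
apply: (EvComp (ws := [:: F v; G v; H v])); last exact: hp.
apply: EvCons; first exact: hF.
apply: EvCons; first exact: hG.
by apply: EvCons; [exact: hH | exact: EvNil].
Qed.

Lemma map_nth_iota_size (v : seq nat) k :
  size v = k -> [seq nth 0%N v i | i <- iota 0 k] = v.
Proof. by move=> <-; rewrite map_nth_iota0 // take_size. Qed.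

(** [RPrec] recurses on the head of its list, so the code puts [N v] in front of a copy of [v] made
    of projections. The [nat_rect] form lets an iteration such as [state] match by conversion. *)
Lemma computes_rec k N F G :
  computes k N -> computes k F -> computes k.+2 G ->
  computes k (fun v => nat_rect (fun=> nat) (F v)
                         (fun i z => G [:: i, z & v]) (N v)).
Proof.
move=> [pN hN] [pF hF] [pG hG].
exists (RComp (RPrec pF pG) (pN :: [seq RProj i | i <- iota 0 k])) => v hv.
apply: (EvComp (ws := N v :: v)).
  apply: EvCons; first exact: hN.
  rewrite -[X in recfun_evals _ _ X](map_nth_iota_size hv).
  exact: recfun_evals_proj.
elim: (N v) => [|n IH] /=; first by constructor; exact: hF.
by apply: EvPrecS; [exact: IH | apply: hG; rewrite /= hv].
Qed.

Lemma computes_succ k F : computes k F -> computes k (fun v => (F v).+1).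
Proof.
move=> hF; apply: (computes_app1 (f := S)) => //.
by exists RSucc => v _; constructor.
Qed.

Lemma computes_const k n : computes k (fun=> n).
Proof.
elim: n => [|n IH]; last exact: computes_succ.
by exists RZero => v _; constructor.
Qed.

Lemma computes_add k F G :
  computes k F -> computes k G -> computes k (fun v => F v + G v)%N.
Proof.
move=> hF hG; apply: (computes_app2 (f := addn)) hF hG.
apply: computes_ext (computes_rec (computes_proj 2 1) (computes_proj 2 0)
  (computes_succ (computes_proj 4 1))) => v _.
by elim: (nth 0%N v 1) => [|n IH] /=; rewrite ?addn0 // IH addnS.
Qed.

Lemma computes_sum k N G :
  computes k N -> computes k.+1 G ->
  computes k (fun v => \sum_(i < N v) G (nat_of_ord i :: v))%N.
Proof.
move=> hN [pG hG].
have hG' : computes k.+2 (fun w => G (nth 0%N w 0 :: drop 2 w)).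
  exists (RComp pG (RProj 0 :: [seq RProj i | i <- iota 2 k])) => w hw.
  apply: (EvComp (ws := nth 0%N w 0 :: drop 2 w)); last first.
    by apply: hG; rewrite /= size_drop hw; lia.
  apply: EvCons; first by constructor.
  have <- : [seq nth 0%N w i | i <- iota 2 k] = drop 2 w.
    apply: (@eq_from_nth _ 0%N) => [|i]; rewrite size_map size_iota.
      by rewrite size_drop hw; lia.
    by move=> ik; rewrite (nth_map 0%N) ?size_iota // nth_iota // nth_drop.
  exact: recfun_evals_proj.
apply: computes_ext (computes_rec hN (computes_const k 0)
  (computes_add (computes_proj k.+2 1) hG')) => v _.
elim: (N v) => [|n IH] /=; first by rewrite big_ord0.
by rewrite big_ord_recr /= IH drop0.
Qed.

Lemma computes_mul k F G :
  computes k F -> computes k G -> computes k (fun v => F v * G v)%N.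
Proof.
move=> hF hG; apply: (computes_app2 (f := muln)) hF hG.
apply: computes_ext (computes_sum (computes_proj 2 0) (computes_proj 3 2)) => v _.
by rewrite /= sum_nat_const card_ord.
Qed.

Lemma computes_sub k F G :
  computes k F -> computes k G -> computes k (fun v => F v - G v)%N.
Proof.
move=> hF hG; apply: (computes_app2 (f := subn)) hF hG.
have hpred : computes 1 (fun v => (nth 0%N v 0).-1).
  apply: computes_ext (computes_rec (computes_proj 1 0) (computes_const 1 0)
    (computes_proj 3 0)) => v _.
  by case: (nth 0%N v 0).
apply: computes_ext (computes_rec (computes_proj 2 1) (computes_proj 2 0)
  (computes_app1 (f := predn) hpred (computes_proj 4 1))) => v _.
by elim: (nth 0%N v 1) => [|n IH] /=; rewrite ?subn0 // IH subnS.
Qed.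

Lemma computes_leq k F G :
  computes k F -> computes k G -> computes k (fun v => nat_of_bool (F v <= G v)%N).
Proof.
move=> hF hG.
apply: computes_ext (computes_sub (computes_const k 1) (computes_sub hF hG)).
by move=> v _; rewrite /leq; case: (F v - G v)%N => [|d]; rewrite ?subSS ?sub0n.
Qed.

Lemma computes_exp2 k F : computes k F -> computes k (fun v => 2 ^ F v)%N.
Proof.
move=> hF; apply: (computes_app1 (f := expn 2)) hF.
apply: computes_ext (computes_rec (computes_proj 1 0) (computes_const 1 1)
  (computes_add (computes_proj 3 1) (computes_proj 3 1))) => v _.
by elim: (nth 0%N v 0) => [|n IH] //=; rewrite IH expnS mul2n addnn.
Qed.

Lemma sum_nat_ltn (k n : nat) : (\sum_(i < n) (i < k)%N = minn n k)%N.
Proof.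
elim: n => [|n IH]; first by rewrite big_ord0 min0n.
rewrite big_ord_recr /= IH; lia.
Qed.

(** The quotient a / b counts the i < a with (i + 1) b <= a. For b = 0 this count would be a, so a
    factor testing 1 <= b restores the convention a / 0 = 0. *)
Lemma computes_div k F G :
  computes k F -> computes k G -> computes k (fun v => F v %/ G v)%N.
Proof.
move=> hF hG; apply: (computes_app2 (f := divn)) hF hG.
have hsum := computes_sum (computes_proj 2 0) (computes_leq (computes_mul
  (computes_succ (computes_proj 3 0)) (computes_proj 3 2)) (computes_proj 3 1)).
apply: computes_ext (computes_mul hsum (computes_leq (computes_const 2 1)
  (computes_proj 2 1))) => v _ /=.
case: (posnP (nth 0%N v 1)) => [->|d0]; first by rewrite divn0 muln0.
rewrite muln1.
under eq_bigr do rewrite -leq_divRL //.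
by rewrite sum_nat_ltn; apply/minn_idPr; exact: leq_div.
Qed.

(** The logarithm counts the i < a with 2^(i + 1) <= a. *)
Lemma computes_log2 k F :
  computes k F -> computes k (fun v => trunc_log 2 (F v)).
Proof.
move=> hF; apply: (computes_app1 (f := trunc_log 2)) hF.
have hsum := computes_sum (computes_proj 1 0) (computes_leq (computes_exp2
  (computes_succ (computes_proj 2 0))) (computes_proj 2 1)).
apply: computes_ext hsum => v _ /=.
case: (posnP (nth 0%N v 0)) => [->|n0]; first by rewrite big_ord0 trunc_log0.
have pow2_leq i : (2 ^ i.+1 <= nth 0%N v 0)%N = (i < trunc_log 2 (nth 0%N v 0))%N.
  apply/idP/idP => [|ilog]; first exact: trunc_log_max.
  by apply: leq_trans (trunc_logP (ltnSn 1) n0); rewrite leq_exp2l.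
under eq_bigr do rewrite pow2_leq.
rewrite sum_nat_ltn; apply/minn_idPr.
by apply: leq_trans (trunc_logP (ltnSn 1) n0); exact/ltnW/ltn_expl.
Qed.

(** * The prefix-halving process *)

(* A prefix of a string of length [n] is coded by [c < 2 ^ n.+1]; its extensions
   to length [n] have the codes [y] with [y %/ block_size n c = c].  The value
   [N t y / 2 ^ t] stands for the mass known at time [t] of the string coded
   by [y]. *)
Definition block_size (n c : nat) : nat := 2 ^ (n - trunc_log 2 c).

Definition in_block (n c y : nat) : bool := (y %/ block_size n c)%N == c.

Definition block_mass (N : nat -> nat -> nat) (n t c : nat) : nat :=
  \sum_(i < block_size n c) N t (c * block_size n c + i)%N.

(** The reciprocals telescope to a sum of at most 1 over all lengths. Each serves as a positive
    reserve for its level, even while no mass is known there. *)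
Definition inv_weight (n : nat) : nat := n.+1 * n.+2.

(** This is q, chosen so that (1 + 1/q)^n contains 4 (log n + 1) groups of q factors, each group
    worth at least 2. It vanishes for small n. *)
Definition gain (n : nat) : nat := n %/ (4 * (trunc_log 2 n).+1).

(** The condition q m_t(E) > 2 W_t, multiplied by [inv_weight n] and 2^t to stay in the naturals;
    [c < 2 ^ n] says that the prefix is still shorter than n. *)
Definition heavy (N : nat -> nat -> nat) (n t c : nat) : bool :=
  ((c < 2 ^ n) &&
   (2 * (inv_weight n * block_mass N n t 1 + 2 ^ t)
      < gain n * (inv_weight n * block_mass N n t c)))%N.

(** Arithmetic form of a conditional: 2 c + b when [c] is heavy, else [c]. The bit b is 1 exactly
    when the right half is strictly lighter. *)
Definition next (N : nat -> nat -> nat) (n t c : nat) : nat :=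
  (c + heavy N n t c *
     (c + (block_mass N n t (2 * c).+1 < block_mass N n t (2 * c))))%N.

Definition state (N : nat -> nat -> nat) (n t : nat) : nat :=
  nat_rect (fun=> nat) 1%N (next N n) t.

Lemma computes_block_size k F G :
  computes k F -> computes k G -> computes k (fun v => block_size (F v) (G v)).
Proof.
by move=> hF hG; exact: computes_exp2 (computes_sub hF (computes_log2 hG)).
Qed.

Lemma computes_block_mass N k F G H :
  computes 2 (fun v => N (nth 0%N v 0) (nth 0%N v 1)) ->
  computes k F -> computes k G -> computes k H ->
  computes k (fun v => block_mass N (F v) (G v) (H v)).
Proof.
move=> hN hF hG hH; apply: (computes_app3 (f := block_mass N)) hF hG hH.
have hsize i j k' := computes_block_size (computes_proj k' i) (computes_proj k' j).
exact: (computes_sum (hsize 0 2 3) (computes_app2 hN (computes_proj 4 2)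
  (computes_add (computes_mul (computes_proj 4 3) (hsize 1 3 4))
                (computes_proj 4 0)))).
Qed.

Lemma computes_inv_weight k F :
  computes k F -> computes k (fun v => inv_weight (F v)).
Proof.
by move=> hF; exact: computes_mul (computes_succ hF) (computes_succ (computes_succ hF)).
Qed.

Lemma computes_gain k F : computes k F -> computes k (fun v => gain (F v)).
Proof.
move=> hF; exact: computes_div hF
  (computes_mul (computes_const k 4) (computes_succ (computes_log2 hF))).
Qed.

Lemma computes_next N k F G H :
  computes 2 (fun v => N (nth 0%N v 0) (nth 0%N v 1)) ->
  computes k F -> computes k G -> computes k H ->
  computes k (fun v => next N (F v) (G v) (H v)).
Proof.
move=> hN hF hG hH.
have hmass := computes_block_mass hN hF hG.
have h2H := computes_mul (computes_const k 2) hH.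
have hu := computes_inv_weight hF.
have hheavy := computes_mul (computes_leq (computes_succ hH) (computes_exp2 hF))
  (computes_leq (computes_succ (computes_mul (computes_const k 2) (computes_add
     (computes_mul hu (hmass _ (computes_const k 1))) (computes_exp2 hG))))
  (computes_mul (computes_gain hF) (computes_mul hu (hmass _ hH)))).
have hright := computes_leq (computes_succ (hmass _ (computes_succ h2H))) (hmass _ h2H).
apply: computes_ext (computes_add hH (computes_mul hheavy (computes_add hH hright))).
by move=> v _; rewrite mulnb.
Qed.

Lemma computes_state N k F G :
  computes 2 (fun v => N (nth 0%N v 0) (nth 0%N v 1)) ->
  computes k F -> computes k G -> computes k (fun v => state N (F v) (G v)).
Proof.
move=> hN hF hG; apply: (computes_app2 (f := state N)) hF hG.
exact: (computes_rec (computes_proj 2 1) (computes_const 2 1)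
  (computes_next hN (computes_proj 4 2) (computes_proj 4 0) (computes_proj 4 1))).
Qed.

Lemma computes_in_block k F G H :
  computes k F -> computes k G -> computes k H ->
  computes k (fun v => nat_of_bool (in_block (F v) (G v) (H v))).
Proof.
move=> hF hG hH.
have hd := computes_div hH (computes_block_size hF hG).
apply: computes_ext (computes_mul (computes_leq hd hG) (computes_leq hG hd)).
by move=> v _; rewrite mulnb -eqn_leq.
Qed.

(** * Blocks as intervals of codes *)

Lemma trunc_log2_child (c : nat) (b : bool) :
  (0 < c)%N -> trunc_log 2 (2 * c + b) = (trunc_log 2 c).+1.
Proof.
move=> c0; rewrite trunc_log2S; last by lia.
by rewrite mul2n addnC half_bit_double.
Qed.

Lemma trunc_log2_lt (n c : nat) : (0 < c)%N -> (trunc_log 2 c < n)%N = (c < 2 ^ n)%N.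
Proof.
move=> c0; apply/idP/idP => h.
  by apply: leq_trans (trunc_log_ltn c (ltnSn 1)) _; rewrite leq_exp2l.
by rewrite -(ltn_exp2l _ _ (ltnSn 1)); exact: leq_ltn_trans (trunc_logP _ _) h.
Qed.

Lemma block_size_child (n c : nat) (b : bool) :
  (0 < c < 2 ^ n)%N -> block_size n c = (2 * block_size n (2 * c + b))%N.
Proof.
move=> /andP[c0 cn]; rewrite /block_size trunc_log2_child // -expnS.
by congr expn; move: cn; rewrite -trunc_log2_lt //; lia.
Qed.

Lemma block_mass_child N (n t c : nat) : (0 < c < 2 ^ n)%N ->
  block_mass N n t c = (block_mass N n t (2 * c) + block_mass N n t (2 * c).+1)%N.
Proof.
move=> cn; rewrite /block_mass.
have h0 := block_size_child false cn; have h1 := block_size_child true cn.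
rewrite addn0 in h0; rewrite addn1 in h1.
have <- : block_size n (2 * c) = block_size n (2 * c).+1 by lia.
rewrite h0 mul2n -addnn big_split_ord /=.
by congr addn; apply: eq_bigr => i _; congr (N t _); lia.
Qed.

Lemma in_block_child (n c y : nat) (b : bool) :
  (0 < c < 2 ^ n)%N -> in_block n (2 * c + b) y -> in_block n c y.
Proof.
move=> cn /eqP yb; rewrite /in_block (block_size_child b cn) mulnC divnMA yb.
by apply/eqP; lia.
Qed.

Lemma block_size_bounds (n c : nat) : (0 < c < 2 ^ n.+1)%N ->
  (2 ^ n <= c * block_size n c)%N /\ (c.+1 * block_size n c <= 2 ^ n.+1)%N.
Proof.
move=> /andP[c0 cn]; rewrite -trunc_log2_lt // ltnS in cn.
have e : (2 ^ n = 2 ^ trunc_log 2 c * block_size n c)%N by rewrite -expnD subnKC.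
rewrite expnS e mulnA -expnS !leq_pmul2r ?expn_gt0 //.
by split; [exact: trunc_logP | exact: trunc_log_ltn].
Qed.

(** With s the block size, the block is the interval from c s to (c + 1) s - 1. It lies inside the
    level by [block_size_bounds], so filtering the level by [in_block] leaves exactly this
    interval. *)
Lemma block_massE N (n t c : nat) : (0 < c < 2 ^ n.+1)%N ->
  block_mass N n t c = (\sum_(2 ^ n <= y < 2 ^ n.+1 | in_block n c y) N t y)%N.
Proof.
move=> cn; have [lo hi] := block_size_bounds cn.
have h0 : (0 < block_size n c)%N by rewrite expn_gt0.
transitivity (\sum_(c * block_size n c <= y < c.+1 * block_size n c) N t y)%N.
  rewrite /block_mass mulSn -[X in index_iota X _]add0n big_addn addnK big_mkord.
  by apply: eq_bigr => i _; rewrite addnC.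
rewrite (big_nat_widen _ _ _ _ _ hi) (big_nat_widenl _ _ _ _ _ lo).
apply: eq_bigl => y /=; rewrite /in_block eqn_leq -[(_ %/ _ <= c)%N]ltnS.
by rewrite ltn_divLR // leq_divRL //.
Qed.

Lemma block_mass_root N (n t : nat) :
  block_mass N n t 1 = (\sum_(2 ^ n <= y < 2 ^ n.+1) N t y)%N.
Proof.
rewrite block_massE; last by rewrite -[1%N](expn0 2) ltn_exp2l.
rewrite big_nat_cond [RHS]big_nat_cond; apply: eq_bigl => y.
rewrite /in_block /block_size trunc_log1 subn0.
case: (boolP (_ <= y < _)%N) => //= /andP[lo hi].
rewrite eqn_leq -[(_ %/ _ <= 1)%N]ltnS ltn_divLR ?expn_gt0 //.
by rewrite leq_divRL ?expn_gt0 // mul1n -expnS lo hi.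
Qed.

(** The known mass outside a fixed block never decreases with time; this is stated without
    subtraction, the factor 2 accounting for the change of unit from 2^-t to 2^-(t+1). *)
Lemma block_mass_complement_le N (n t c : nat) :
  (forall y, (2 * N t y <= N t.+1 y)%N) -> (0 < c < 2 ^ n.+1)%N ->
  (2 * block_mass N n t 1 + block_mass N n t.+1 c <=
   block_mass N n t.+1 1 + 2 * block_mass N n t c)%N.
Proof.
move=> mono cn; rewrite !block_mass_root !block_massE //.
have split2 f := bigID (in_block n c) xpredT f (op := addn)
  (r := index_iota (2 ^ n) (2 ^ n.+1)).
rewrite !split2 /=.
have : (2 * \sum_(2 ^ n <= y < 2 ^ n.+1 | ~~ in_block n c y) N t y <=
        \sum_(2 ^ n <= y < 2 ^ n.+1 | ~~ in_block n c y) N t.+1 y)%N.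
  by rewrite big_distrr /=; apply: leq_sum.
lia.
Qed.

(** * Evolution of the prefix and its potential *)

Lemma next_cases N (n t c : nat) :
  next N n t c = c /\ ~~ heavy N n t c \/
  exists b : bool, [/\ heavy N n t c, next N n t c = (2 * c + b)%N &
    ((0 < c)%N -> 2 * block_mass N n t (2 * c + b) <= block_mass N n t c)%N].
Proof.
rewrite /next; case: (boolP (heavy _ _ _ _)) => hv; last by left; rewrite mul0n addn0.
right; set b := (_ < _)%N; exists b; split => //; first by lia.
move=> c0; have cn : (0 < c < 2 ^ n)%N by rewrite c0; case/andP: hv.
rewrite (block_mass_child N t cn).
rewrite /b; case: (ltnP (block_mass N n t (2 * c).+1)) => h /=;
  rewrite ?addn1 ?addn0; lia.
Qed.

Lemma state_bounds N (n t : nat) : (0 < state N n t < 2 ^ n.+1)%N.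
Proof.
elim: t => [|t /andP[c0 cn]] /=; first by rewrite -[1%N](expn0 2) ltn_exp2l.
case: (next_cases N n t (state N n t)) => [[-> _]|]; first by rewrite c0.
case=> b [/andP[c2n _] -> _]; rewrite expnS; lia.
Qed.

Lemma state_nondecreasing N (n : nat) :
  {homo state N n : s t / (s <= t)%N}.
Proof.
apply: homo_leq => [//|a b c|t]; first exact: leq_trans.
by rewrite [state N n t.+1]/= /next leq_addr.
Qed.

(** Blocks shrink with time, which makes the approximations of the test nonincreasing. *)
Lemma in_block_state N (n s t y : nat) :
  (s <= t)%N -> in_block n (state N n t) y -> in_block n (state N n s) y.
Proof.
move=> st; rewrite -(subnKC st); elim: (t - s)%N => [|d IH]; first by rewrite addn0.
rewrite addnS => /= h; apply: IH; move: h.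
have /andP[c0 _] := state_bounds N n (s + d).
case: (next_cases N n (s + d) (state N n (s + d))) => [[-> _]//|].
case=> b [/andP[c2n _] -> _]; apply: in_block_child.
by rewrite c0.
Qed.

(* Dividing by [q ^ k * 2 ^ t] and writing S for the mass of level n plus
   1 / inv_weight n: (1 + 1/q)^k / inv_weight n + (mass of the block) <= S. A
   heavy block has mass > 2 S / q, so halving it discards at least S / q, which
   pays for one more factor 1 + 1/q. *)
Lemma state_potential N (n t : nat) (q := gain n) (u := inv_weight n)
    (c := state N n t) (k := trunc_log 2 c) :
  (forall s y, (2 * N s y <= N s.+1 y)%N) ->
  (2 ^ t * q.+1 ^ k + q ^ k * (u * block_mass N n t c) <=
   q ^ k * (u * block_mass N n t 1 + 2 ^ t))%N.
Proof.
move=> mono; rewrite {}/k {}/c; elim: t => [|t IH].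
  by rewrite /= trunc_log1; lia.
have cn := state_bounds N n t.+1.
have le := block_mass_complement_le (mono t) cn.
set c' := state N n t.+1 in cn le *; set k' := trunc_log 2 c'.
(* One time step is split in two: [h] moves the prefix with the masses of time t, and then [le]
   passes to the masses of time t + 1 with the prefix fixed. *)
suff h : (2 ^ t * q.+1 ^ k' + q ^ k' * (u * block_mass N n t c') <=
          q ^ k' * (u * block_mass N n t 1 + 2 ^ t))%N.
  have := leq_mul (leqnn (q ^ k' * u)) le.
  rewrite expnS.
  move: (q ^ k')%N (q.+1 ^ k')%N h => Q Q' h; move: (2 ^ t)%N h => p h.
  move: (block_mass N n t 1) (block_mass N n t c') (block_mass N n t.+1 1)
    (block_mass N n t.+1 c') h => a b a' b'.
  by nia.
have /andP[c0 _] := state_bounds N n t.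
rewrite {}/k' {}/c' [state N n t.+1]/= in le cn *.
case: (next_cases N n t (state N n t)) => [[-> _]//|[b [hv -> half]]].
rewrite trunc_log2_child // !expnS.
have {half} := half c0; case/andP: hv => _; move: IH; rewrite -/q -/u.
move: (q ^ _)%N (q.+1 ^ _)%N (2 ^ t)%N => Q Q' p.
move: (block_mass N n t 1) (block_mass N n t (state N n t))
  (block_mass N n t (2 * _ + b)) => a x x'.
move=> pot hv half.
(* After multiplying [pot] by q, it remains to pay for p Q' out of q Q u x. By [pot], p Q' <= Q (u a
   + p), which heaviness bounds by half of q Q u x; the retained half block takes at most the other
   half. *)
have h1 : (2 * (u * x') <= u * x)%N by nia.
have h2 : (2 * (Q * (u * a + p)) <= Q * q * (u * x))%N.
  by rewrite mulnCA -mulnA leq_mul2l ltnW ?orbT.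
have h3 : (2 * (Q * q * (u * x')) <= Q * q * (u * x))%N.
  by rewrite mulnCA leq_mul2l h1 orbT.
have h4 := leq_mul (leqnn q) pot.
nia.
Qed.

(** * Growth of (1 + 1/q)^n and stabilization *)

Lemma bernoulli_nat (q j : nat) : (q ^ j * (q + j) <= q.+1 ^ j * q)%N.
Proof.
elim: j => [|j IH]; first by rewrite !expn0 addn0.
have := leq_mul (leqnn q.+1) IH; rewrite !expnS.
move: (q ^ j)%N (q.+1 ^ j)%N => Q Q'; nia.
Qed.

(** Bernoulli's inequality gives (1 + 1/q)^q >= 2; this is its j-th power. *)
Lemma expn_succ_double (q j : nat) :
  (0 < q)%N -> (2 ^ j * q ^ (q * j) <= q.+1 ^ (q * j))%N.
Proof.
move=> q0; case: j => [|j]; first by rewrite muln0.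
rewrite !expnM -expnMn leq_exp2r // -(leq_pmul2r q0).
by have := bernoulli_nat q q; lia.
Qed.

(** With l = floor(log n) + 1, the exponent n contains 4 l groups of q factors, so (1 + 1/q)^n >=
    2^(4 l) >= (n + 1)^4, which exceeds (n + 1)(n + 2) + 1. *)
Lemma inv_weight_lt (n : nat) : (0 < gain n)%N ->
  ((inv_weight n).+1 * gain n ^ n < (gain n).+1 ^ n)%N.
Proof.
move=> q0; set q := gain n; set l := (trunc_log 2 n).+1.
have ql : (q * (4 * l) <= n)%N by exact: leq_divM.
have n4 : (4 <= n)%N.
  by apply: leq_trans ql; rewrite -[4%N]mul1n leq_mul // mul1n leq_pmulr.
have u4 : ((inv_weight n).+1 < 2 ^ (4 * l))%N.
  have nl : (n.+1 <= 2 ^ l)%N by exact: trunc_log_ltn.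
  rewrite mulnC expnM; apply: (@leq_trans (n.+1 ^ 4)%N); last by rewrite leq_exp2r.
  by rewrite /inv_weight !expnS expn0; nia.
have qn : (q ^ (n - q * (4 * l)) <= q.+1 ^ (n - q * (4 * l)))%N.
  by case: (n - _)%N => // d; rewrite leq_exp2r.
have := leq_mul (expn_succ_double (4 * l) q0) qn.
rewrite -mulnA -!expnD subnKC //; apply: leq_trans.
by rewrite ltn_pmul2r // expn_gt0 q0.
Qed.

(** At a prefix of full length n, the potential would force (1 + 1/q)^n <= [inv_weight n] + 1, since
    the level has mass at most 1. This contradicts [inv_weight_lt]. *)
Lemma state_lt N (n t : nat) :
  (forall s y, (2 * N s y <= N s.+1 y)%N) -> (block_mass N n t 1 <= 2 ^ t)%N ->
  (0 < gain n)%N -> (state N n t < 2 ^ n)%N.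
Proof.
move=> mono mass1 q0; have /andP[c0 cn] := state_bounds N n t.
rewrite ltnNge; apply/negP => nc.
have kn : trunc_log 2 (state N n t) = n by apply: trunc_log_eq; rewrite ?nc.
have := state_potential n t mono; rewrite kn.
have := inv_weight_lt q0.
have : (0 < 2 ^ t)%N by rewrite expn_gt0.
move: mass1; move: (gain n ^ n)%N ((gain n).+1 ^ n)%N => Q Q'.
move: (2 ^ t)%N (block_mass N n t 1) (inv_weight n * block_mass N n t (state N n t))%N.
move=> p a x ap p0 uQ pot.
have h1 : (inv_weight n * a + p <= (inv_weight n).+1 * p)%N.
  by rewrite mulSn addnC leq_add2l leq_mul2l ap orbT.
have h2 := leq_mul (leqnn Q) h1.
have h3 : (p * ((inv_weight n).+1 * Q) < p * Q')%N by rewrite ltn_mul2l p0.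
nia.
Qed.

(** Codes never decrease and stay below 2^(n + 1), so the largest code ever visited is final. The
    time T is obtained classically, without a computable bound. *)
Lemma state_stationary N (n : nat) :
  exists T, forall t, (T <= t)%N -> state N n t = state N n T.
Proof.
pose P c := `[< exists t, state N n t = c >].
have exP : exists c, P c by exists (state N n 0); apply/asboolP; exists 0%N.
have ubP c : P c -> (c <= 2 ^ n.+1)%N.
  by move=> /asboolP[t <-]; apply: ltnW; case/andP: (state_bounds N n t).
case: (ex_maxnP exP ubP) => c /asboolP[T <-] maxT; exists T => t Tt.
apply/anti_leq/andP; split; last exact: state_nondecreasing.
by apply: maxT; apply/asboolP; exists t.
Qed.

(** A heavy final block would be halved once more, changing its code. By [state_lt] the length
    condition in [heavy] holds, so it is the mass condition that fails. *)
Lemma stationary_block_mass_le N (n T t : nat) :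
  (forall s y, (2 * N s y <= N s.+1 y)%N) ->
  (forall s, block_mass N n s 1 <= 2 ^ s)%N ->
  (forall s, (T <= s)%N -> state N n s = state N n T) -> (T <= t)%N ->
  (gain n * (inv_weight n * block_mass N n t (state N n T)) <=
   2 * (inv_weight n * block_mass N n t 1 + 2 ^ t))%N.
Proof.
move=> mono mass1 stat Tt; have [->|q0] := posnP (gain n); first by rewrite mul0n.
have := stat t.+1 (leqW Tt); rewrite -(stat t Tt) [state N n t.+1]/=.
have /andP[c0 _] := state_bounds N n t.
have := state_lt mono (mass1 t) q0; move: (state N n t) c0 => c c0 c2n.
case: (next_cases N n t c) => [[_ nhv] _|[b [_ -> _]]]; last by lia.
by move: nhv; rewrite /heavy c2n /= -leqNgt.
Qed.

(** * Strings and their codes *)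

Fixpoint low_bits (k y : nat) : seq bool :=
  if k is k'.+1 then rcons (low_bits k' y./2) (odd y) else [::].

Definition string_decode (y : nat) : seq bool := low_bits (trunc_log 2 y) y.

Lemma string_code_rcons x b : string_code (rcons x b) = (2 * string_code x + b)%N.
Proof. by rewrite /string_code map_rcons foldl_rcons mul2n. Qed.

Lemma string_code_gt0 x : (0 < string_code x)%N.
Proof.
elim/last_ind: x => [//|x b IH]; rewrite string_code_rcons.
by rewrite addn_gt0 muln_gt0 IH.
Qed.

Lemma trunc_log2_string_code x : trunc_log 2 (string_code x) = size x.
Proof.
elim/last_ind: x => [//|x b IH].
by rewrite string_code_rcons trunc_log2_child ?string_code_gt0 // IH size_rcons.
Qed.

Lemma size_string_decode y : size (string_decode y) = trunc_log 2 y.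
Proof.
rewrite /string_decode; move: (trunc_log 2 y) => k; elim: k y => //= k IH y.
by rewrite size_rcons IH.
Qed.

Lemma string_codeK : cancel string_code string_decode.
Proof.
elim/last_ind => [//|x b IH].
rewrite /string_decode string_code_rcons trunc_log2_child ?string_code_gt0 //=.
rewrite mul2n addnC half_bit_double oddD odd_double addbF oddb.
by congr rcons.
Qed.

Lemma string_decodeK y : (0 < y)%N -> string_code (string_decode y) = y.
Proof.
rewrite /string_decode; move: {-1}(trunc_log 2 y) (erefl (trunc_log 2 y)) => k.
elim: k y => [|k IH] y /= yk y0.
  have : (y < 2)%N by have := trunc_log_ltn y (ltnSn 1); rewrite yk.
  by rewrite /string_code /=; lia.
have y1 : (1 < y)%N.
  by have := trunc_logP (ltnSn 1) y0; rewrite yk expnS; have := expn_gt0 2 k; lia.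
move: yk; rewrite trunc_log2S // => -[yk].
rewrite string_code_rcons IH //; last by rewrite half_gt0.
by rewrite mul2n addnC odd_double_half.
Qed.

(** The number 0 also decodes to the empty string, whose code is 1. The correction is written as a
    computable function of [y]. *)
Lemma string_code_decode y : string_code (string_decode y) = (y + (y <= 0))%N.
Proof. by case: y => [//|y]; rewrite string_decodeK // addn0. Qed.

Lemma string_code_lt x K : (size x < K)%N -> (string_code x < 2 ^ K)%N.
Proof. by rewrite -trunc_log2_string_code trunc_log2_lt // string_code_gt0. Qed.

(** * Sums over strings as sums over codes *)

Definition short_strings (K : nat) : seq (seq bool) :=
  [seq string_decode y | y <- index_iota 1 (2 ^ K)].

Lemma mem_short_strings x K : (size x < K)%N -> x \in short_strings K.
Proof.
move=> xK; rewrite -(string_codeK x) map_f // mem_index_iota string_code_gt0.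
exact: string_code_lt.
Qed.

Lemma fsum_short_strings (R : realType) (a : seq bool -> R) K :
  (\sum_(x \in [set` short_strings K]) (a x)%:E)%E =
  (\sum_(1 <= y < 2 ^ K) a (string_decode y))%:E.
Proof.
rewrite -fsbig_seq; first by rewrite big_map sumEFin.
rewrite map_inj_in_uniq ?iota_uniq // => y z; rewrite !mem_index_iota.
move=> /andP[y1 _] /andP[z1 _] /(congr1 string_code).
by rewrite !string_decodeK.
Qed.

(** Any finite set of strings lies in [short_strings K] once K exceeds all its lengths, and the
    terms are nonnegative. *)
Lemma esum_string_le (R : realType) (a : seq bool -> R) (B : R) :
  (forall x, 0 <= a x) ->
  (forall K, \sum_(1 <= y < 2 ^ K) a (string_decode y) <= B) ->
  (\esum_(x in [set: seq bool]) (a x)%:E <= B%:E)%E.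
Proof.
move=> a0 aB; apply: ge_ereal_sup => _ [X [/finite_seqP[s ->] _] <-].
pose K := (\max_(x <- s) size x).+1.
apply: le_trans (_ : (_ <= \sum_(x \in [set` short_strings K]) (a x)%:E)%E) _.
  apply: lee_fsum_nneg_subset => [||x|x _]; [exact: finite_seq..| |by rewrite lee_fin].
  rewrite !inE => xs; apply: mem_short_strings.
  by rewrite ltnS (leq_bigmax_seq (F := size)).
by rewrite fsum_short_strings lee_fin.
Qed.

Lemma sum_string_le (R : realType) (a : seq bool -> R) (B : R) K :
  (\esum_(x in [set: seq bool]) (a x)%:E <= B%:E)%E ->
  \sum_(1 <= y < 2 ^ K) a (string_decode y) <= B.
Proof.
rewrite -lee_fin; apply: le_trans; rewrite -fsum_short_strings.
apply: esum_ge; exists [set` short_strings K]%classic; last exact: lexx.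
by split; [exact: finite_seq | move=> x _].
Qed.

Lemma sum_levels (V : nmodType) (f : nat -> V) K :
  \sum_(1 <= y < 2 ^ K) f y = \sum_(n < K) \sum_(2 ^ n <= y < 2 ^ n.+1) f y.
Proof.
elim: K => [|K IH]; first by rewrite big_ord0 expn0 big_geq.
rewrite big_ord_recr /= -IH -big_cat_nat ?expn_gt0 //.
by rewrite leq_exp2l.
Qed.

Lemma sum_inv_weight (R : realType) K :
  \sum_(n < K) (inv_weight n)%:R^-1 <= 1 :> R.
Proof.
suff -> : \sum_(n < K) (inv_weight n)%:R^-1 = 1 - K.+1%:R^-1 :> R.
  by rewrite gerBl invr_ge0.
elim: K => [|K IH]; first by rewrite big_ord0 invr1 subrr.
rewrite big_ord_recr /= IH /inv_weight natrM -!natr1.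
have K0 : 0 <= K%:R :> R by [].
by field; apply/andP; split; lra.
Qed.

(** * Dyadic approximations and passage to the limit *)

(** [N t y] is the floor of 2^t times the positive part of the t-th approximation, truncated
    subtraction supplying the positive part. The common denominator 2^t lets the process run on
    naturals. *)
Lemma semicomputable_dyadic (R : realType) (m : seq bool -> R) :
  (forall x, 0 <= m x) -> lower_semicomputable m ->
  exists N : nat -> nat -> nat,
    [/\ computes 2 (fun v => N (nth 0%N v 0) (nth 0%N v 1)),
        forall t y, (2 * N t y <= N t.+1 y)%N,
        forall t y, (N t y)%:R / 2 ^+ t <= m (string_decode y) &
        forall y, ((fun t => (N t y)%:R / 2 ^+ t : R) @ \oo -->
                   m (string_decode y))%classic].
Proof.
move=> m0 [f [[a [b [d [[pa ca] [pb cb] [pd cd] fE]]]] fmono fm]].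
pose A y t := a (string_decode y) t; pose B y t := b (string_decode y) t.
pose D y t := d (string_decode y) t.
pose F y t : R := ((A y t)%:R - (B y t)%:R) / (D y t).+1%:R.
have FE y t : ratr (f (string_decode y) t) = F y t.
  by rewrite fE fmorph_div rmorphB /= !ratr_nat.
have Fmono y : nondecreasing_seq (F y).
  by move=> s t st; rewrite -!FE ler_rat fmono.
have Fm y : (F y @ \oo --> m (string_decode y))%classic.
  rewrite (_ : F y = fun t => ratr (f (string_decode y) t)) //.
  by apply/funext => t; rewrite FE.
have Fle y t : F y t <= m (string_decode y).
  rewrite -(cvg_lim _ (Fm y)) //; apply: nondecreasing_cvgn_le => //.
  by apply/cvg_ex; exists (m (string_decode y)).
pose N t y := ((A y t - B y t) * 2 ^ t %/ (D y t).+1)%N.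
have p2 t : 0 < 2 ^+ t :> R by exact: exprn_gt0.
have d0 y t : 0 < (D y t).+1%:R :> R by rewrite ltr0n.
have Nle t y : (N t y * (D y t).+1 <= (A y t - B y t) * 2 ^ t)%N by exact: leq_divM.
have NR t y : (N t y)%:R * (D y t).+1%:R <= (A y t - B y t)%:R * 2 ^+ t :> R.
  by rewrite -natrX -!natrM ler_nat.
have Nm t y : (N t y)%:R / 2 ^+ t <= m (string_decode y).
  rewrite ler_pdivrMr //.
  have [AB|BA] := leqP (A y t) (B y t).
    move: AB; rewrite /N -subn_eq0 => /eqP ->.
    by rewrite mul0n div0n mulr_ge0 // ltW.
  apply: le_trans (ler_wpM2r (ltW (p2 t)) (Fle y t)).
  by rewrite /F mulrAC ler_pdivlMr // -(natrB R (ltnW BA)).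
exists N; split.
(* The given codes are specified only on codes of strings, so 0 is first replaced by 1. *)
- have hcode : computes 2 (fun v => nth 0%N v 1 + (nth 0%N v 1 <= 0))%N.
    exact: computes_add (computes_proj 2 1)
      (computes_leq (computes_proj 2 1) (computes_const 2 0)).
  have comp p (g : seq bool -> nat -> nat) :
      (forall x t, recfun_eval p [:: string_code x; t] (g x t)) ->
      computes 2 (fun v => g (string_decode (nth 0%N v 1)) (nth 0%N v 0)).
    move=> cg; have [pc hc] := hcode.
    exists (RComp p [:: pc; RProj 0]) => v hv.
    apply: EvComp (cg (string_decode (nth 0%N v 1)) (nth 0%N v 0)).
    apply: EvCons; first by rewrite string_code_decode; exact: hc.
    by apply: EvCons; constructor.
  exact: computes_div (computes_mul (computes_sub (comp _ _ ca) (comp _ _ cb))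
    (computes_exp2 (computes_proj 2 0))) (computes_succ (comp _ _ cd)).
- move=> t y; rewrite leq_divRL // expnS.
  (* Monotonicity of the positive parts, cross-multiplied. Then 2 [N t y] is an integer at most
     2^(t+1) times the next positive part, hence at most its floor. *)
  have h : ((A y t - B y t) * (D y t.+1).+1 <= (A y t.+1 - B y t.+1) * (D y t).+1)%N.
    have [AB|BA] := leqP (A y t) (B y t).
      by move: AB; rewrite -subn_eq0 => /eqP ->.
    have := Fmono y _ _ (leqnSn t).
    rewrite /F ler_pdivrMr // mulrAC ler_pdivlMr // -(natrB R (ltnW BA)).
    rewrite -(ler_nat R) !natrM => /le_trans; apply.
    by rewrite ler_wpM2r // lerBlDr -natrD ler_nat; lia.
  rewrite -(leq_pmul2r (ltn0Sn (D y t))).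
  have := leq_mul (leqnn (2 * 2 ^ t)) h.
  have := leq_mul (leqnn (2 * (D y t.+1).+1)) (Nle t y).
  lia.
- exact: Nm.
- move=> y.
  (* Rounding down loses less than one unit 2^-t. *)
  apply: (@squeeze_cvgr _ _ _ _ (fun t => F y t - 2^-1 ^+ t) (fun=> m (string_decode y))).
  + near=> t; apply/andP; split; last exact: Nm.
    rewrite lerBlDr exprVn -[X in _ <= _ + X]mul1r -mulrDl ler_pdivlMr //.
    rewrite /F mulrAC ler_pdivrMr // natr1.
    have := ltn_ceil ((A y t - B y t) * 2 ^ t)%N (ltn0Sn (D y t)).
    move=> /ltnW; rewrite -(ler_nat R) !natrM natrX; apply: le_trans.
    by rewrite ler_pM2r // lerBlDr -natrD ler_nat; lia.
  + rewrite -[X in (_ --> X)%classic]subr0; apply: cvgB => //.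
    by apply: cvg_expr; rewrite ger0_norm; lra.
  + exact: cvg_cst.
Unshelve. all: by end_near.
Qed.

Lemma stationary_level_sum_le (R : realType) (g : nat -> R)
    (N : nat -> nat -> nat) (n T : nat) :
  (forall t y, (2 * N t y <= N t.+1 y)%N) ->
  (forall t y, (N t y)%:R / 2 ^+ t <= g y) ->
  (forall y, ((fun t => (N t y)%:R / 2 ^+ t : R) @ \oo --> g y)%classic) ->
  \sum_(2 ^ n <= y < 2 ^ n.+1) g y <= 1 ->
  (forall t, (T <= t)%N -> state N n t = state N n T) ->
  (gain n)%:R * \sum_(2 ^ n <= y < 2 ^ n.+1 | in_block n (state N n T) y) g y <=
  2 * (\sum_(2 ^ n <= y < 2 ^ n.+1) g y + (inv_weight n)%:R^-1).
Proof.
move=> mono Ng cvgN g1 stat.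
have p2 t : 0 < 2 ^+ t :> R by exact: exprn_gt0.
have cn := state_bounds N n T; set c := state N n T in cn stat *.
have massR t : (block_mass N n t 1)%:R / 2 ^+ t <= \sum_(2 ^ n <= y < 2 ^ n.+1) g y.
  by rewrite block_mass_root natr_sum mulr_suml; apply: ler_sum.
have mass1 t : (block_mass N n t 1 <= 2 ^ t)%N.
  have := le_trans (massR t) g1.
  by rewrite ler_pdivrMr // mul1r -natrX ler_nat.
have u0 : 0 < (inv_weight n)%:R :> R by rewrite ltr0n.
(* Only the left side needs a limit: at each t, [massR] bounds the right side by its final value. *)
apply: ler_cvg_to (_ : (fun t => (gain n)%:R *
    \sum_(2 ^ n <= y < 2 ^ n.+1 | in_block n c y) ((N t y)%:R / 2 ^+ t))
    @ \oo --> _)%classic (cvg_cst _) _.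
  apply: cvgM; first exact: cvg_cst.
  by apply: cvg_big => [|y _]; [exact: add_continuous | exact: cvgN].
exists T => // t /= Tt.
have := stationary_block_mass_le mono mass1 stat Tt.
move: (inv_weight n) u0 => u u0.
rewrite -/c -mulr_suml -natr_sum -block_massE // -(ler_nat R) !(natrM, natrD) natrX.
move=> h; have := massR t; set W := \sum_(_ <= _ < _) _ => hW.
apply: le_trans (_ : 2 * ((block_mass N n t 1)%:R / 2 ^+ t + u%:R^-1) <= _).
  move: h; move: (block_mass N n t c)%:R (block_mass N n t 1)%:R => a b h.
  have up : 0 < u%:R * 2 ^+ t :> R by exact: mulr_gt0.
  have -> : (gain n)%:R * (a / 2 ^+ t) =
      (gain n)%:R * (u%:R * a) / (u%:R * 2 ^+ t).
    by field; rewrite !gt_eqF.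
  have -> : 2 * (b / 2 ^+ t + u%:R^-1) =
      2 * (u%:R * b + 2 ^+ t) / (u%:R * 2 ^+ t).
    by field; rewrite !gt_eqF.
  by rewrite ler_pM2r ?invr_gt0.
by rewrite ler_pM2l // lerD2r.
Qed.

(** * Size of the gain *)

Lemma log2_ge (R : realType) (n j : nat) : (2 ^ j <= n)%N -> j%:R <= log2 n%:R :> R.
Proof.
move=> jn; have ln2 : 0 < ln 2 :> R by rewrite ln_gt0 // ltr1n.
have n0 : (0 < n)%N by apply: leq_trans jn; rewrite expn_gt0.
rewrite /log2 ler_pdivlMr // mulr_natl -lnXn // ler_ln ?posrE ?exprn_gt0 ?ltr0n //.
by rewrite -natrX ler_nat.
Qed.

(** From n < 4 (k + 1)(q + 1) and q >= 1 follows n <= 8 (k + 1) q; with k + 1 <= 2 L <= 2 L^5 this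
    gives n <= 16 q L^5, and the test value q / 4 turns 16 into 64. *)
Lemma gain_ge (R : realType) (n : nat) : (32 <= n)%N ->
  64^-1 * (n%:R / log2 n%:R ^+ 5) <= (gain n)%:R / 4 :> R.
Proof.
move=> n32; set k := trunc_log 2 n; set L : R := log2 n%:R.
have n0 : (0 < n)%N by lia.
have k5 : (5 <= k)%N by exact: trunc_log_max.
have kn : (2 ^ k <= n)%N by exact: trunc_logP.
have kL : k%:R <= L by exact: log2_ge.
(* The inequality 4 (k + 1) <= 2^k holds from k = 5 on, whence the threshold 32. *)
have gt0 : (0 < gain n)%N.
  rewrite divn_gt0 //; apply: leq_trans kn; rewrite -/k.
  rewrite -(subnK k5) addnC; elim: (k - 5)%N => // j IH.
  by rewrite addnS expnS; lia.
have h : (n <= 8 * k.+1 * gain n)%N.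
  have := ltn_ceil n (isT : (0 < 4 * k.+1)%N); rewrite -/(gain n); nia.
have L1 : 1 <= L by apply: le_trans kL; rewrite ler1n; lia.
have L5 : L <= L ^+ 5 by rewrite exprS ler_peMr ?expr_ge1 //; lra.
have kL5 : k.+1%:R <= 2 * L ^+ 5 by rewrite -natr1; lra.
rewrite mulrA ler_pdivrMr; last by rewrite exprn_gt0 //; lra.
have : n%:R <= (8 * k.+1 * gain n)%:R :> R by rewrite ler_nat.
rewrite !natrM; have : 0 <= (gain n)%:R :> R by [].
move: (gain n)%:R (n%:R : R) (L ^+ 5) (k.+1%:R : R) kL5 => q x z w.
nra.
Qed.

(** * The test and its properties *)

Lemma computes_computable_nat F :
  computes 2 F -> computable_nat (fun x t => F [:: string_code x; t]).
Proof. by move=> [p hp]; exists p => x t; exact: hp. Qed.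

(** Four times the approximation of the test at time [t], an integer. *)
Definition surviving_gain (N : nat -> nat -> nat) (x : seq bool) (t : nat) : nat :=
  gain (size x) * in_block (size x) (state N (size x) t) (string_code x).

Lemma computable_surviving_gain N :
  computes 2 (fun v => N (nth 0%N v 0) (nth 0%N v 1)) ->
  computable_nat (surviving_gain N).
Proof.
move=> hN.
have hn := computes_log2 (computes_proj 2 0).
have := computes_computable_nat (computes_mul (computes_gain hn) (computes_in_block hn
  (computes_state hN hn (computes_proj 2 1)) (computes_proj 2 0))).
case=> p hp; exists p => x t; have := hp x t.
by rewrite /= trunc_log2_string_code.
Qed.

Lemma upper_semicomputable_surviving_gain (R : realType) N (T : nat -> nat) :
  computes 2 (fun v => N (nth 0%N v 0) (nth 0%N v 1)) ->
  (forall n t, (T n <= t)%N -> state N n t = state N n (T n)) ->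
  upper_semicomputable (fun x => (surviving_gain N x (T (size x)))%:R / 4 : R).
Proof.
move=> hN stat; exists (fun x t => (surviving_gain N x t)%:R / 4); split.
(* A stored denominator d stands for d + 1, so 3 encodes division by 4. *)
- exists (surviving_gain N), (fun _ _ => 0%N), (fun _ _ => 3%N); split.
  + exact: computable_surviving_gain.
  + exact: computes_computable_nat (computes_const 2 0).
  + exact: computes_computable_nat (computes_const 2 3).
  + by move=> x t; rewrite subr0.
- move=> x s t st; rewrite ler_pM2r // ler_nat leq_mul2l.
  case: (boolP (in_block _ (state N _ t) _)) => [/(in_block_state st)->|_];
    by rewrite ?orbT.
- move=> x; apply: cvg_near_cst; exists (T (size x)) => // t /= Tt.
  by rewrite /surviving_gain stat // fmorph_div /= !ratr_nat.
Qed.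

Theorem theorem3 (R : realType) (m : seq bool -> R) (hm : universal m) :
  exists (e : seq bool -> R) (c : R) (N : nat),
    [/\ upper_semicomputable e,
        sumtest m e,
        0 < c &
        forall n : nat, (N <= n)%N ->
          exists x : seq bool,
            size x = n /\ c * (n%:R / log2 n%:R ^+ 5) <= e x].
Proof.
case: hm => lower_m [m0 m1] _.
have [N [hN mono Nm cvgN]] := semicomputable_dyadic m0 lower_m.
pose g y := m (string_decode y).
have g0 y : 0 <= g y by exact: m0.
have sum_g K : \sum_(1 <= y < 2 ^ K) g y <= 1 by exact: sum_string_le.
have level_g n : \sum_(2 ^ n <= y < 2 ^ n.+1) g y <= 1.
  apply: le_trans (sum_g n.+1); rewrite sum_levels big_ord_recr /= lerDr.
  by apply: sumr_ge0 => i _; apply: sumr_ge0.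
have [T stat] : exists T : nat -> nat, forall n t, (T n <= t)%N ->
    state N n t = state N n (T n).
  exists (fun n => projT1 (cid (state_stationary N n))) => n t.
  by case: cid => T' /= hT'; exact: hT'.
exists (fun x => (surviving_gain N x (T (size x)))%:R / 4), 64^-1, 32%N.
split; [exact: upper_semicomputable_surviving_gain | | by [] |].
- split=> [x|]; first exact: divr_ge0.
  apply: esum_string_le => [x|K]; first by rewrite mulr_ge0 // divr_ge0.
  rewrite sum_levels.
  (* A quarter of the stationary bound 2 (W + reserve) is (W + reserve) / 2; the masses and the
     reserves each sum to at most 1 over all levels. *)
  apply: le_trans (_ : \sum_(n < K) ((\sum_(2 ^ n <= y < 2 ^ n.+1) g y +
      (inv_weight n)%:R^-1) / 2) <= _).
    apply: ler_sum => n _.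
    have := stationary_level_sum_le mono Nm cvgN (level_g n) (stat n).
    rewrite big_mkcond /= mulr_sumr.
    set S := \sum_(_ <= _ < _) _; set W := \sum_(_ <= _ < _) _ => SW.
    apply: le_trans (_ : S / 4 <= _); last by lra.
    rewrite /S mulr_suml !big_nat; apply: ler_sum => y yn.
    have y0 : (0 < y)%N by apply: leq_trans (expn_gt0 2 n) _; case/andP: yn.
    have -> : size (string_decode y) = n.
      by rewrite size_string_decode; exact: trunc_log_eq.
    rewrite /surviving_gain size_string_decode (trunc_log_eq _ yn) // string_decodeK //.
    rewrite natrM -/(g y); case: in_block; rewrite ?mulr1 ?mulr0 ?mul0r ?mulr0 //.
    by rewrite mulrA [g y * _]mulrC.
  rewrite -mulr_suml big_split /= -sum_levels.
  have := sum_g K; have := sum_inv_weight R K; lra.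
- move=> n n32; have gain_n := gain_ge R n32.
  have /andP[c0 cn] := state_bounds N n (T n).
  have [lo hi] := block_size_bounds (state_bounds N n (T n)).
  set c := state N n (T n) in c0 cn lo hi.
  have h0 : (0 < block_size n c)%N by rewrite expn_gt0.
  have yn : (2 ^ n <= c * block_size n c < 2 ^ n.+1)%N.
    by rewrite lo (leq_trans _ hi) // ltn_pmul2r.
  (* The leftmost string of the final block: the prefix padded with zeros to length n. *)
  exists (string_decode (c * block_size n c)).
  have size_x : size (string_decode (c * block_size n c)) = n.
    by rewrite size_string_decode; exact: trunc_log_eq.
  split=> //; rewrite /surviving_gain size_x string_decodeK; last by rewrite muln_gt0 c0.
  by rewrite -/c /in_block mulnK // eqxx muln1.
Qed.
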